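(* Let $\mathbb{K}$ be a field, $n\ge 2$, $d\ge 2$, and let $F=\{f_1,\dots,f_n\}$ be a set of $n$ square free monomials of the same degree $d$, with $f_i\in\mathbb{K}[x_1,\dots,x_n]$ for $i=1,\dots,n$, satisfying the canonical restrictions. Suppose that $f_i=x_ng_i$ for $i=1,\dots,n-1$ and $x_n\nmid f_n$. Set $\tilde F=\{g_1,\dots,g_{n-1}\}$, considered as a set of square free monomials of degree $d-1$ in $\mathbb{K}[x_1,\dots,x_{n-1}]$. (1) If $\tilde F$ does not satisfy the canonical restrictions, then $F$ is not a Cremona set. (2) If $\tilde F$ satisfies the canonical restrictions, then $F$ is a Cremona set if and only if $\tilde F$ is a Cremona set.
   Context: A set $F=\{f_1,\dots,f_m\}$ of $m$ monomials of the same degree $d$ in $\mathbb{K}[x_1,\dots,x_m]$ satisfies the canonical restrictions if for each $j=1,\dots,m$ there is a $k$ with $x_j\mid f_k$ and there is a $k$ with $x_j\nmid f_k$. $F$ is a Cremona set if the extension $\mathbb{K}[f_1,\dots,f_m]\subset \mathbb{K}[\underline{x}_d]$ becomes an equality on the level of fields of fractions, where $\mathbb{K}[\underline{x}_d]$ is the algebra generated by all monomials of degree $d$ in $x_1,\dots,x_m$ (equivalently, the rational map $\mathbb{P}^{m-1}\dashrightarrow\mathbb{P}^{m-1}$ given by $(f_1:\dots:f_m)$ is birational). A monomial is square free if it is not divisible by $x_i^2$ for any $i$. *)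

(* Defs.v *)
From HB Require Import structures.
From mathcomp Require Import all_boot all_order all_algebra.
From mathcomp Require Export mpoly.

Set Implicit Arguments.
Unset Strict Implicit.
Unset Printing Implicit Defensive.

Import GRing.Theory.
Local Open Scope ring_scope.

(* Monomials of K[x_1, ..., x_n] are exponent vectors m : 'X_{1..n}; the
   polynomial is 'X_[m], multiplication is (_ + _)%MM, the variable x_j is
   U_(j)%MM, and divisibility is the pointwise order (_ <= _)%MM. *)

Definition square_free (n : nat) (m : 'X_{1..n}) : Prop :=
  forall j : 'I_n, ~~ (U_(j) + U_(j) <= m)%MM.

Definition canonical_restrictions (n : nat) (f : 'I_n -> 'X_{1..n}) : Prop :=
  forall j : 'I_n,
    (exists k : 'I_n, (U_(j) <= f k)%MM) /\
    (exists k : 'I_n, ~~ (U_(j) <= f k)%MM).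

(* K[S]: the polynomial expressions q(t_1, ..., t_k), with coefficients in K,
   in finitely many elements t_1, ..., t_k of S. *)
Definition generated_algebra (K : fieldType) (n : nat)
    (S : {mpoly K[n]} -> Prop) (p : {mpoly K[n]}) : Prop :=
  exists (k : nat) (t : k.-tuple {mpoly K[n]}) (q : {mpoly K[k]}),
    (forall i : 'I_k, S (tnth t i)) /\ p = q \mPo t.

(* Frac(A), realized inside the field K(x_1, ..., x_n). *)
Definition fractions_of (K : fieldType) (n : nat)
    (A : {mpoly K[n]} -> Prop) (z : {fraction {mpoly K[n]}}) : Prop :=
  exists a b : {mpoly K[n]},
    [/\ A a, A b, b != 0 & z = tofrac a / tofrac b].

Definition in_family (K : fieldType) (n : nat) (f : 'I_n -> 'X_{1..n})
    (p : {mpoly K[n]}) : Prop :=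
  exists i : 'I_n, p = 'X_[f i].

Definition monomial_of_degree (K : fieldType) (n d : nat)
    (p : {mpoly K[n]}) : Prop :=
  exists m : 'X_{1..n}, mdeg m = d /\ p = 'X_[m].

(* Only meaningful when every f i has degree d. *)
Definition cremona (K : fieldType) (n d : nat) (f : 'I_n -> 'X_{1..n}) : Prop :=
  forall z : {fraction {mpoly K[n]}},
    fractions_of (generated_algebra (in_family f)) z <->
    fractions_of (generated_algebra (@monomial_of_degree K n d)) z.

Arguments cremona : clear implicits.

(* Main.v *)
Require Import Defs.
From HB Require Import structures.
From mathcomp Require Import all_boot all_order all_algebra.
From mathcomp Require Import mpoly.
From mathcomp Require Import zify.

(** A family [f] of monomials of degree [d] is a Cremona set if and only if
    every exponent vector of degree [d] lies in the lattice spanned by the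
    exponent vectors of [f]. On the lattice side, the coefficients of a vector
    of degree [d] sum to [1], because every generator has degree [d] as well.

    If no [g k] involves [x_j], then the exponents of [x_j] and [x_n] sum to
    [1] in every [f i], hence in every degree [d] vector of the lattice; if every
    [g k] involves [x_j], these two exponents agree throughout the lattice. Both
    are contradicted by [x_n ^ d].

    If [u] of degree [d - 1] is such that [x_n u] is in the lattice of [f], then
    reading off the exponent of [x_n] shows that [f n] occurs with coefficient
    [0], so [u] is in the lattice of [g]. Conversely, if the lattice of [g]
    contains all degree [d - 1] vectors, writing [f n = x_j h] gives
    [x_n / x_j = x_n h / f n], and all [x_n / x_j] and all [x_n u] generate
    every monomial of degree [d]. *)

Set Implicit Arguments.
Unset Strict Implicit.

(** * Exponent vectors and the integer lattices they span *)

Section Lattice.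

Import GRing.Theory.
Local Open Scope ring_scope.

(** Integer entries make quotients of monomials available as differences, whereas subtraction in
    ['X_{1..n}] truncates. *)
Definition exponent_row {n : nat} (u : 'X_{1..n}) : 'rV[int]_n :=
  \row_j (u j)%:Z.

Definition in_lattice {k n : nat} (f : 'I_k -> 'X_{1..n}) (v : 'rV[int]_n) : Prop :=
  exists c : 'I_k -> int, v = \sum_i c i *: exponent_row (f i).

Lemma exponent_rowD n (u v : 'X_{1..n}) :
  exponent_row (u + v)%MM = exponent_row u + exponent_row v.
Proof. by apply/rowP => j; rewrite !mxE mnmDE PoszD. Qed.

Lemma exponent_rowMn n (u : 'X_{1..n}) (a : nat) :
  exponent_row (u *+ a)%MM = a%:Z *: exponent_row u.
Proof. by apply/rowP => j; rewrite !mxE mulmnE PoszM mulrC. Qed.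

Lemma exponent_row_sum n (I : finType) (F : I -> 'X_{1..n}) :
  exponent_row (\sum_i F i)%MM = \sum_i exponent_row (F i).
Proof.
apply: (big_morph exponent_row (@exponent_rowD n)).
by apply/rowP => j; rewrite !mxE mnm0E.
Qed.

Lemma exponent_row_inj n : injective (@exponent_row n).
Proof.
by move=> u v /rowP uv; apply/mnmP => j; have := uv j; rewrite !mxE => -[].
Qed.

Lemma mdeg_subU n (u : 'X_{1..n}) i :
  (U_(i) <= u)%MM -> (mdeg (u - U_(i))%MM).+1 = mdeg u.
Proof. by move=> ui; rewrite -{2}(submK ui) mdegD mdeg1 addn1. Qed.

Section Closure.

Context {k n : nat} (f : 'I_k -> 'X_{1..n}).

Lemma in_lattice_comb (I : finType) (c : I -> int) (v : I -> 'rV[int]_n) :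
  (forall i, in_lattice f (v i)) -> in_lattice f (\sum_i c i *: v i).
Proof.
move=> /fin_all_exists [a va]; exists (fun l => \sum_i c i * a i l).
under eq_bigr => i _ do rewrite va scaler_sumr.
rewrite exchange_big; apply: eq_bigr => l _.
by rewrite scaler_suml; apply: eq_bigr => i _; rewrite scalerA.
Qed.

Lemma in_latticeD v w : in_lattice f v -> in_lattice f w -> in_lattice f (v + w).
Proof.
move=> [a ->] [b ->]; exists (fun i => a i + b i).
by rewrite -big_split; apply: eq_bigr => i _; rewrite scalerDl.
Qed.

Lemma in_latticeB v w : in_lattice f v -> in_lattice f w -> in_lattice f (v - w).
Proof.
move=> [a ->] [b ->]; exists (fun i => a i - b i).
by rewrite -sumrB; apply: eq_bigr => i _; rewrite scalerBl.
Qed.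

Lemma in_lattice_gen i : in_lattice f (exponent_row (f i)).
Proof.
exists (fun j => (j == i)%:R); rewrite (bigD1 i) //= eqxx scale1r big1 ?addr0 //.
by move=> j /negPf ->; rewrite scale0r.
Qed.

(** Splitting each coefficient into a difference of two naturals turns a lattice vector into a
    quotient of two monomials in the [f i]. *)
Lemma in_lattice_clear_denominators u : in_lattice f (exponent_row u) ->
  exists a b : 'I_k -> nat,
    (u + \sum_i f i *+ b i = \sum_i f i *+ a i)%MM.
Proof.
(* [c i] plus its absolute value is nonnegative, so the outer absolute value leaves it unchanged. *)
move=> [c uc]; exists (fun i => `|(c i + `|c i|%N%:Z)%R|%N), (fun i => `|c i|%N).
apply: exponent_row_inj; rewrite exponent_rowD uc !exponent_row_sum -big_split /=.
apply: eq_bigr => i _; rewrite !exponent_rowMn -scalerDl; congr (_ *: _).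
lia.
Qed.

(** The sum of the entries is linear and equals [d] on [u] and on every generator; then [d]
    cancels. *)
Lemma lattice_coef_sum (d : nat) (u : 'X_{1..n}) (c : 'I_k -> int) :
  (0 < d)%N -> (forall i, mdeg (f i) = d) -> mdeg u = d ->
  exponent_row u = \sum_i c i *: exponent_row (f i) -> \sum_i c i = 1.
Proof.
move=> d_gt0 f_deg u_deg uc.
have row_deg (v : 'X_{1..n}) : \sum_j exponent_row v 0 j = (mdeg v)%:Z.
  by rewrite mdegE -natz natr_sum; apply: eq_bigr => j _; rewrite mxE natz.
have: (\sum_i c i) * d%:Z = d%:Z.
  rewrite -{2}u_deg -row_deg uc mulr_suml.
  under [RHS]eq_bigr do rewrite summxE.
  rewrite [RHS]exchange_big; apply: eq_bigr => i _.
  rewrite -(f_deg i) -row_deg mulr_sumr.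
  by apply: eq_bigr => j _; rewrite !mxE.
nia.
Qed.

End Closure.

(** * Birationality as a lattice condition *)

Section Criterion.

Variable K : fieldType.

(** With one fixed tuple of generators, closure under ring operations is immediate: composition is a
    ring morphism. *)
Definition family_algebra {k n} (f : 'I_k -> 'X_{1..n}) (p : {mpoly K[n]}) : Prop :=
  exists q : {mpoly K[k]}, p = q \mPo [tuple 'X_[f i] | i < k].

Lemma family_algebraD k n (f : 'I_k -> 'X_{1..n}) p q :
  family_algebra f p -> family_algebra f q -> family_algebra f (p + q).
Proof. by move=> [a ->] [b ->]; exists (a + b); rewrite rmorphD. Qed.

Lemma family_algebraM k n (f : 'I_k -> 'X_{1..n}) p q :
  family_algebra f p -> family_algebra f q -> family_algebra f (p * q).
Proof. by move=> [a ->] [b ->]; exists (a * b); rewrite rmorphM. Qed.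

Lemma family_algebraZ k n (f : 'I_k -> 'X_{1..n}) (c : K) p :
  family_algebra f p -> family_algebra f (c *: p).
Proof. by move=> [a ->]; exists (c *: a); rewrite comp_mpolyZ. Qed.

Lemma family_algebra_monomial k n (f : 'I_k -> 'X_{1..n}) (a : 'I_k -> nat) :
  family_algebra f 'X_[(\sum_i f i *+ a i)%MM].
Proof.
exists 'X_[[multinom a i | i < k]]; rewrite comp_mpolyX -mprodXnE.
by apply: eq_bigr => i _; rewrite tnth_mktuple mnmE.
Qed.

Lemma family_algebra_generated n (f : 'I_n -> 'X_{1..n}) p :
  family_algebra f p -> generated_algebra (in_family f) p.
Proof.
move=> [q ->]; exists n, [tuple 'X_[f i] | i < n], q; split=> // i.
by exists i; rewrite tnth_mktuple.
Qed.

(** Expanding [q \mPo t] yields only products of powers of lattice monomials, whose exponents stay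
    in the lattice. *)
Lemma msupp_generated k n (f : 'I_k -> 'X_{1..n})
    (S : {mpoly K[n]} -> Prop) p :
  (forall s, S s -> exists u, in_lattice f (exponent_row u) /\ s = 'X_[u]) ->
  generated_algebra S p ->
  forall u, u \in msupp p -> in_lattice f (exponent_row u).
Proof.
move=> S_lattice [l [t [q [tS ->]]]] u.
have /fin_all_exists [v vP] i := S_lattice _ (tS i).
rewrite mcoeff_msupp comp_mpolyE raddf_sum /=.
(* If no monomial of [q] is sent to [u], every term contributes 0 to the coefficient of [u]. *)
have [[w _ /eqP ->] | none] := altP (@hasP _ (fun w : 'X_{1..l} =>
    u == (\sum_i v i *+ w i)%MM) (msupp q)); last first.
  rewrite big_seq big1 ?eqxx // => w w_supp; rewrite mcoeffZ.
  under eq_bigr => i _ do rewrite (vP i).2.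
  rewrite mprodXnE mcoeffX eq_sym; case: eqP => [uw | _]; last by rewrite mulr0.
  by case/negP: none; apply/hasP; exists w => //; apply/eqP.
move=> _; rewrite exponent_row_sum.
under eq_bigr do rewrite exponent_rowMn.
by apply: in_lattice_comb => i; case: (vP i).
Qed.

(** Places [p] in the fraction field of the family's algebra: [b] is the product of denominators of
    the monomials of [p]. *)
Lemma lattice_denominator n k (f : 'I_k -> 'X_{1..n}) (p : {mpoly K[n]}) :
  (forall u, u \in msupp p -> in_lattice f (exponent_row u)) ->
  exists b, [/\ family_algebra f b, b != 0 & family_algebra f (b * p)].
Proof.
move=> p_lattice.
have zero_alg : family_algebra f 0 by exists 0; rewrite rmorph0.
have [b [fb b0 bX]] : exists b, [/\ family_algebra f b, b != 0 &
    forall u, u \in msupp p -> family_algebra f (b * 'X_[u])].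
  elim: (msupp p : seq _) p_lattice => [_|u s IHs s_lattice].
    exists 1; split=> //; last exact: oner_neq0.
    by exists 1; rewrite rmorph1.
  have [|b [fb b0 bX]] := IHs.
    by move=> v vs; apply: s_lattice; rewrite inE vs orbT.
  have [|a [c uac]] := @in_lattice_clear_denominators _ _ f u.
    by apply: s_lattice; rewrite mem_head.
  have fc := family_algebra_monomial f c.
  exists ('X_[(\sum_i f i *+ c i)%MM] * b); split.
  - exact: family_algebraM.
  - by rewrite mulf_neq0 // -msupp_eq0 msuppX.
  move=> v; rewrite inE => /predU1P[-> | vs]; last first.
    by rewrite -mulrA; apply: family_algebraM => //; apply: bX.
  rewrite mulrAC -mpolyXD addmC uac; apply: family_algebraM => //.
  exact: family_algebra_monomial.
exists b; split=> //; rewrite [X in b * X]mpolyE mulr_sumr big_seq.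
apply: big_ind => // [x y|u us]; first exact: family_algebraD.
by rewrite -scalerAr; apply: family_algebraZ; apply: bX.
Qed.

Lemma cremona_lattice n d (f : 'I_n -> 'X_{1..n}) :
  (forall i, mdeg (f i) = d) ->
  cremona K n d f <->
  (forall u, mdeg u = d -> in_lattice f (exponent_row u)).
Proof.
move=> f_deg; split=> [f_crem u u_deg | f_lattice z].
  have /f_crem [a [b [a_alg b_alg b0 ab]]] :
      fractions_of (generated_algebra (@monomial_of_degree K n d))
        (tofrac 'X_[u]).
    exists 'X_[u], 1; split; last by rewrite tofrac1 divr1.
    - exists 1%N, [tuple 'X_[u]], 'X_ord0; split; last by rewrite comp_mpolyXU.
      by move=> i; exists u; rewrite (ord1 i).
    - exists 0%N, [tuple], 1; split; first by case.
      by rewrite comp_mpoly1.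
    - exact: oner_neq0.
  have {ab} Xba : 'X_[u] * b = a.
    apply/eqP; rewrite -tofrac_eq tofracM ab divfK //.
    by rewrite tofrac_eq0.
  have gens s : in_family f s ->
      exists u, in_lattice f (exponent_row u) /\ s = 'X_[K, u].
    by move=> [i ->]; exists (f i); split=> //; apply: in_lattice_gen.
  (* Multiplication by ['X_[u]] shifts the support by [u], so [u] is a monomial of [a] minus a
     monomial of [b]. *)
  have b_supp : mlead b \in msupp b by exact: mlead_supp.
  have a_supp : (u + mlead b)%MM \in msupp a.
    by rewrite -Xba mulrC mcoeff_msupp mcoeffMX -mcoeff_msupp.
  have := in_latticeB (msupp_generated gens a_alg a_supp)
    (msupp_generated gens b_alg b_supp).
  by rewrite exponent_rowD addrK.
split=> [[a [b [[k [t [q [tf ->]]]] [k' [t' [q' [t'f ->]]]] b0 ->]]]|].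
  have gens s : in_family f s -> @monomial_of_degree K n d s.
    by move=> [i ->]; exists (f i).
  by eexists _, _; split; last reflexivity;
     [exists k, t, q; split=> // i; apply: gens
     |exists k', t', q'; split=> // i; apply: gens|].
move=> [a [b [a_alg b_alg b0 ->]]].
have gens s : @monomial_of_degree K n d s ->
    exists u, in_lattice f (exponent_row u) /\ s = 'X_[u].
  by move=> [u [u_deg ->]]; exists u; split=> //; apply: f_lattice.
have [p [fp p0 fpa]] := lattice_denominator (msupp_generated gens a_alg).
have [q [fq q0 fqb]] := lattice_denominator (msupp_generated gens b_alg).
(* Expanding [a / b] by [p * q] brings numerator and denominator into the algebra of [f]. *)
exists (q * (p * a)), (p * (q * b)); split.
- by apply: family_algebra_generated; apply: family_algebraM.
- by apply: family_algebra_generated; apply: family_algebraM.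
- by rewrite !mulf_neq0.
rewrite mulrCA !tofracM -!mulf_div !divff ?mul1r //; by rewrite tofrac_eq0.
Qed.

End Criterion.

(** * Comparing the lattices of [f] and [g] *)

Section Deletion.

Context {m d : nat} {f : 'I_m.+1 -> 'X_{1..m.+1}} {g : 'I_m -> 'X_{1..m}}.
Hypotheses (hd : (2 <= d)%N) (f_deg : forall i, mdeg (f i) = d).
Hypothesis f_g : forall i : 'I_m,
  f (widen_ord (leqnSn m) i) = (U_(ord_max) + mnmwiden (g i))%MM.
Hypothesis f_last : f ord_max ord_max = 0%N.

Let widen := widen_ord (leqnSn m).

Lemma widen_max_cases (i : 'I_m.+1) : i = ord_max \/ exists j, i = widen j.
Proof.
have [->|] := eqVneq i ord_max; first by left.
move=> i_max; right; have im : (i < m)%N.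
  have := ltn_ord i; rewrite ltnS leq_eqVlt => /orP[/eqP im|//].
  by case/eqP: i_max; apply: val_inj.
by exists (Ordinal im); apply: val_inj.
Qed.

Lemma widen_neq_max (j : 'I_m) : (widen j == ord_max) = false.
Proof. by apply/eqP => /(congr1 val) /= jm; have := ltn_ord j; rewrite jm ltnn. Qed.

Lemma max_neq_widen (j : 'I_m) : (ord_max == widen j) = false.
Proof. by rewrite eq_sym widen_neq_max. Qed.

Lemma mdeg_mnmwiden (u : 'X_{1..m}) : mdeg (mnmwiden u) = mdeg u.
Proof.
rewrite !mdegE big_ord_recr /= mnmwiden_ordmax addn0.
by apply: eq_bigr => j _; rewrite mnmwiden_widen.
Qed.

Lemma f_widen_max i : f (widen i) ord_max = 1%N.
Proof. by rewrite f_g mnmDE mnm1E eqxx mnmwiden_ordmax. Qed.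

Lemma f_widen_widen i j : f (widen i) (widen j) = g i j.
Proof. by rewrite f_g mnmDE mnm1E max_neq_widen mnmwiden_widen. Qed.

Lemma g_deg i : mdeg (g i) = d.-1.
Proof. by rewrite -(f_deg (widen i)) f_g mdegD mdeg1 mdeg_mnmwiden. Qed.

Lemma lattice_coord (u : 'X_{1..m.+1}) (c : 'I_m.+1 -> int) j :
  exponent_row u = \sum_i c i *: exponent_row (f i) ->
  (u j)%:Z = \sum_i c i * (f i j)%:Z.
Proof.
move=> /rowP /(_ j); rewrite mxE summxE => ->.
by apply: eq_bigr => i _; rewrite !mxE.
Qed.

Lemma lattice_canonical :
  (forall i, square_free (f i)) -> canonical_restrictions f ->
  (forall u, mdeg u = d -> in_lattice f (exponent_row u)) ->
  canonical_restrictions g.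
Proof.
move=> f_sqf f_can f_lattice j.
have f_le1 i k : (f i k <= 1)%N.
  rewrite leqNgt; apply/negP => fik; have /negP[] := f_sqf i k.
  apply/mnm_lepP => l; rewrite mnmDE mnm1E.
  by case: eqP => [<- //|_]; rewrite addn0.
have Xd_deg : mdeg (U_(ord_max) *+ d : 'X_{1..m.+1})%MM = d.
  by rewrite mdegMn mdeg1 mul1n.
have [c Xd] := f_lattice _ Xd_deg.
have c_sum := lattice_coef_sum (ltnW hd) f_deg Xd_deg Xd.
have := lattice_coord ord_max Xd; have := lattice_coord (widen j) Xd.
rewrite !mulmnE !mnm1E eqxx max_neq_widen mul0n mul1n => j_sum max_sum.
split; apply/existsP; apply: contraT; rewrite negb_exists => /forallP no_k.
- have f_sum1 i : (f i (widen j))%:Z + (f i ord_max)%:Z = 1.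
    have [-> | [l ->]] := widen_max_cases i; last first.
      rewrite f_widen_max f_widen_widen.
      by have := no_k l; rewrite lep1mP negbK => /eqP ->.
    (* Some member of [f] involves x_j, which can only be [f ord_max]; square-freeness makes the
       exponent 1. *)
    rewrite f_last addr0; have [[k]] := f_can (widen j).
    have [-> | [l ->]] := widen_max_cases k; last first.
      by rewrite lep1mP f_widen_widen -lep1mP (negPf (no_k l)).
    by rewrite lep1mP; have := f_le1 ord_max (widen j); lia.
  have : 0%:Z + d%:Z = 1.
    rewrite j_sum max_sum -c_sum -big_split.
    by apply: eq_bigr => i _ /=; rewrite -mulrDr f_sum1 mulr1.
  lia.
- have f_same i : f i (widen j) = f i ord_max.
    have [-> | [l ->]] := widen_max_cases i; last first.
      rewrite f_widen_max; have := f_le1 (widen l) (widen j).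
      by rewrite f_widen_widen; have := no_k l; rewrite negbK lep1mP; lia.
    (* Some member of [f] avoids x_j, which can only be [f ord_max]. *)
    rewrite f_last; have [_ [k]] := f_can (widen j).
    have [-> | [l ->]] := widen_max_cases k.
      by rewrite lep1mP negbK => /eqP.
    by rewrite lep1mP f_widen_widen -lep1mP (negPf (no_k l)).
  have : 0%:Z = d%:Z.
    by rewrite j_sum max_sum; apply: eq_bigr => i _; rewrite f_same.
  lia.
Qed.

Lemma lattice_delete :
  (forall u, mdeg u = d -> in_lattice f (exponent_row u)) ->
  forall u, mdeg u = d.-1 -> in_lattice g (exponent_row u).
Proof.
move=> f_lattice u u_deg.
have xu_deg : mdeg (U_(ord_max) + mnmwiden u)%MM = d.
  by rewrite mdegD mdeg1 mdeg_mnmwiden u_deg; lia.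
have [c xuc] := f_lattice _ xu_deg.
have := lattice_coef_sum (ltnW hd) f_deg xu_deg xuc.
have := lattice_coord ord_max xuc.
rewrite !big_ord_recr /= -/widen f_last mulr0 addr0.
rewrite mnmDE mnm1E eqxx mnmwiden_ordmax.
under eq_bigr do rewrite f_widen_max mulr1.
(* All coefficients sum to 1, and so do those other than the last, by the exponent of x_n. *)
move=> <- /(canRL (addKr _)); rewrite addNr => c_max.
exists (fun i => c (widen i)); apply/rowP => j.
rewrite mxE summxE; have := lattice_coord (widen j) xuc.
rewrite big_ord_recr /= -/widen c_max mul0r addr0.
rewrite mnmDE mnm1E max_neq_widen mnmwiden_widen => ->.
by apply: eq_bigr => i _; rewrite !mxE f_widen_widen.
Qed.

Lemma lattice_extend :
  (forall u, mdeg u = d.-1 -> in_lattice g (exponent_row u)) ->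
  forall u, mdeg u = d -> in_lattice f (exponent_row u).
Proof.
move=> g_lattice.
(* The coefficients expressing [u] over [g] sum to 1, so the same combination of the x_n g_i has the
   right exponent 1 at x_n. *)
have x_lattice (v : 'X_{1..m.+1}) : v ord_max = 1%N -> mdeg v = d ->
    in_lattice f (exponent_row v).
  move=> v_max v_deg; pose u := [multinom v (widen j) | j < m].
  have v_u : v = (U_(ord_max) + mnmwiden u)%MM.
    apply/mnmP => k; rewrite mnmDE mnm1E.
    have [-> | [j ->]] := widen_max_cases k.
      by rewrite eqxx mnmwiden_ordmax.
    by rewrite max_neq_widen mnmwiden_widen mnmE.
  have u_deg : mdeg u = d.-1.
    by rewrite -v_deg v_u mdegD mdeg1 mdeg_mnmwiden.
  have [c uc] := g_lattice _ u_deg.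
  have d1_gt0 : (0 < d.-1)%N by lia.
  have c_sum := lattice_coef_sum d1_gt0 g_deg u_deg uc.
  suff -> : exponent_row v = \sum_i c i *: exponent_row (f (widen i)).
    by apply: in_lattice_comb => i; apply: in_lattice_gen.
  apply/rowP => k; rewrite mxE summxE.
  have [-> | [j ->]] := widen_max_cases k.
    rewrite v_max -[LHS]c_sum; apply: eq_bigr => i _.
    by rewrite !mxE f_widen_max mulr1.
  move/rowP/(_ j): uc; rewrite !mxE summxE mnmE => ->.
  by apply: eq_bigr => i _; rewrite !mxE f_widen_widen.
have nonzero_coord (u : 'X_{1..m.+1}) : u ord_max = 0%N -> mdeg u = d ->
    exists j, (U_(widen j) <= u)%MM.
  move=> u_max u_deg; have /existsP [k uk] : [exists k, u k != 0%N].
    apply: contraT; rewrite negb_exists => /forallP u0.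
    suff : d = 0%N by lia.
    by rewrite -u_deg mdegE big1 // => k _; have := u0 k; rewrite negbK => /eqP.
  have [k_max | [j kj]] := widen_max_cases k.
    by rewrite k_max u_max in uk.
  by exists j; rewrite lep1mP -kj.
have [j0 fj0] := nonzero_coord _ f_last (f_deg ord_max).
have swap i :
    in_lattice f (exponent_row U_(ord_max)%MM - exponent_row U_(widen i)%MM).
  (* The quotient of [w i] by [w j0] is x_i / x_j0, which carries x_n / x_j0 over to x_n / x_i; both
     have exponent 1 at x_n. *)
  pose w j : 'X_{1..m.+1} := (U_(ord_max) + U_(widen i) *+ d.-2 + U_(widen j))%MM.
  have w_lattice j : in_lattice f (exponent_row (w j)).
    apply: x_lattice.
      by rewrite !mnmDE mulmnE !mnm1E eqxx !widen_neq_max.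
    by rewrite !mdegD mdegMn !mdeg1; lia.
  have x_f_lattice :
      in_lattice f (exponent_row (U_(ord_max) + (f ord_max - U_(widen j0)))%MM).
    apply: x_lattice.
      by rewrite mnmDE mnmBE !mnm1E eqxx f_last sub0n.
    by rewrite mdegD mdeg1 add1n (mdeg_subU fj0) f_deg.
  suff -> : exponent_row U_(ord_max)%MM - exponent_row U_(widen i)%MM =
      exponent_row (U_(ord_max) + (f ord_max - U_(widen j0)))%MM
      - exponent_row (f ord_max) - (exponent_row (w i) - exponent_row (w j0)).
    apply: in_latticeB; last exact: in_latticeB.
    exact: in_latticeB x_f_lattice (in_lattice_gen f _).
  rewrite -[in X in _ - X - _](submK fj0) !exponent_rowD.
  by apply/rowP => k; rewrite !mxE; lia.
(* Induction on the exponent of x_n. At 0, [u] is x_n u / x_i divided by x_n / x_i. *)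
move=> u; move t_def: (u ord_max) => t; elim: t u t_def => [|t IHt] u u_max u_deg.
  have [i ui] := nonzero_coord u u_max u_deg.
  have xu_lattice : in_lattice f (exponent_row (U_(ord_max) + (u - U_(widen i)))%MM).
    apply: x_lattice.
      by rewrite mnmDE mnmBE !mnm1E eqxx u_max sub0n.
    by rewrite mdegD mdeg1 add1n (mdeg_subU ui).
  have := in_latticeB xu_lattice (swap i).
  suff -> : exponent_row (U_(ord_max) + (u - U_(widen i)))%MM -
    (exponent_row U_(ord_max)%MM - exponent_row U_(widen i)%MM) = exponent_row u by [].
  rewrite -[in RHS](submK ui) !exponent_rowD.
  by apply/rowP => k; rewrite !mxE; lia.
have xu : (U_(ord_max) <= u)%MM by rewrite lep1mP u_max.
(* Trading one x_n for x_j0 keeps the degree and lowers the exponent of x_n. *)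
have u'_lattice : in_lattice f (exponent_row (U_(widen j0) + (u - U_(ord_max)))%MM).
  apply: IHt.
    by rewrite mnmDE mnmBE !mnm1E eqxx widen_neq_max u_max subn1.
  by rewrite mdegD mdeg1 add1n (mdeg_subU xu).
have := in_latticeD u'_lattice (swap j0).
suff -> : exponent_row (U_(widen j0) + (u - U_(ord_max)))%MM +
  (exponent_row U_(ord_max)%MM - exponent_row U_(widen j0)%MM) = exponent_row u by [].
rewrite -[in RHS](submK xu) !exponent_rowD.
by apply/rowP => k; rewrite !mxE; lia.
Qed.

End Deletion.
End Lattice.

Theorem corollary3p4 (K : fieldType) (m d : nat)
    (hn : 2 <= m.+1) (hd : 2 <= d)
    (f : 'I_m.+1 -> 'X_{1..m.+1}) (g : 'I_m -> 'X_{1..m})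
    (f_inj : injective f)
    (f_deg : forall i : 'I_m.+1, mdeg (f i) = d)
    (f_sqf : forall i : 'I_m.+1, square_free (f i))
    (f_can : canonical_restrictions f)
    (* mnmwiden regards g i as a monomial in one more variable, U_(ord_max) *)
    (f_g : forall i : 'I_m,
       f (widen_ord (leqnSn m) i) = (U_(ord_max) + mnmwiden (g i))%MM)
    (f_last : ~~ (U_(ord_max) <= f ord_max)%MM) :
  (~ canonical_restrictions g -> ~ cremona K m.+1 d f) /\
  (canonical_restrictions g -> (cremona K m.+1 d f <-> cremona K m d.-1 g)).
Proof.
have f_last0 : f ord_max ord_max = 0%N.
  by move: f_last; rewrite lep1mP negbK => /eqP.
(* Both Cremona conditions become lattice conditions, in degrees [d] and [d.-1]. *)
rewrite (cremona_lattice K f_deg) (cremona_lattice K (g_deg f_deg f_g)).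
split=> [g_not_can f_lattice | _]; first apply: g_not_can.
  exact: (lattice_canonical hd f_deg f_g f_last0 f_sqf f_can f_lattice).
split.
  exact: (lattice_delete hd f_deg f_g f_last0).
exact: (lattice_extend hd f_deg f_g f_last0).
Qed.
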